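(* There exists a finitely generated hopfian semigroup $S$ which contains a non-hopfian subsemigroup $T$ with $|S\setminus T|=1$.
   Context: A semigroup $S$ is hopfian if every surjective (semigroup) endomorphism $S\to S$ is an automorphism (equivalently, is injective). *)

(* Defs.v *)
From HB Require Import structures.
From mathcomp Require Import all_boot.

Set Implicit Arguments.
Unset Strict Implicit.
Unset Printing Implicit Defensive.

Local Open Scope group_scope.

Definition hopfian (S : semigroupType) : Prop :=
  forall f : {multiplicative S -> S},
    (forall y : S, exists x : S, f x = y) -> bijective f.

(* Nonempty products only: a semigroup need not have an identity. *)
Inductive generated_by (S : semigroupType) (A : seq S) : S -> Prop :=
  | generated_by_gen x : x \in A -> generated_by A x
  | generated_by_mul x y :
      generated_by A x -> generated_by A y -> generated_by A (x * y).

Definition finitely_generated (S : semigroupType) : Prop :=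
  exists A : seq S, forall x : S, generated_by A x.

(* Main.v *)
(** Let T be the monoid with zero generated by t, t^-1, x, where x t^k x = 0 for
    k >= 0, where each x t^k x is fixed by t on both sides, and where words with
    three x are 0.  It is not hopfian: fixing t and sending x to t x is a
    surjective endomorphism which kills x t^-1 x.  Let S = T + {a}, where a
    multiplies as x does.  Being the only element of S which is not a product,
    a is fixed by every surjective endomorphism, hence so is x = 1 a.  Then t
    goes to t or t^-1, and the latter is impossible since x t x = 0 <> x t^-1 x.
    So the identity is the only surjective endomorphism of S. *)
Require Import Defs.
From HB Require Import structures.
From mathcomp Require Import all_boot.
From mathcomp Require Import ssralg ssrint zify.

Set Implicit Arguments.
Unset Strict Implicit.
Unset Printing Implicit Defensive.

Local Open Scope group_scope.

(* [m] is a phantom parameter: it selects the product, in which [None] acts as [m]. *)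
Definition inflation_of (M : Type) (m : M) : Type := option M.
(** A copy of [M] that remembers [m], to carry the subsemigroup structure. *)
Definition inflation_base_of (M : Type) (m : M) : Type := M.

Section Inflation.
Variables (M : monoidType) (m : M).

Notation inflation := (inflation_of m).
Notation inflation_base := (inflation_base_of m).

HB.instance Definition _ := Choice.on inflation.

Definition deflate (u : inflation) : M := odflt m u.
Definition inflation_mul (u v : inflation) : inflation :=
  Some (deflate u * deflate v).

Lemma inflation_mulA : associative inflation_mul.
Proof. by move=> u v w; rewrite /inflation_mul /= mulgA. Qed.

HB.instance Definition _ := isSemigroup.Build inflation inflation_mulA.

HB.instance Definition _ := Monoid.on inflation_base.

Definition base_val (x : inflation_base) : inflation := Some x.
Definition base_sub (u : inflation) (_ : isSome u) : inflation_base := deflate u.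

Lemma base_sub_rect (K : inflation_base -> Type) :
  (forall u (Pu : isSome u), K (base_sub Pu)) -> forall x, K x.
Proof. by move=> H x; exact: (H (Some x) isT). Qed.

Lemma base_subK u (Pu : isSome u) : base_val (base_sub Pu) = u.
Proof. by case: u Pu. Qed.

HB.instance Definition _ :=
  isSub.Build inflation (@isSome M) inflation_base base_sub_rect base_subK.

Lemma base_valM : {morph base_val : x y / x * y}.
Proof. by []. Qed.

HB.instance Definition _ :=
  isSubMagma.Build inflation (@isSome M) inflation_base base_valM.

(* The new element is the only one which is not a product, so a surjective
   endomorphism fixes it; multiplying by 1 then shows that [m] is fixed too. *)
Lemma inflation_surj_endo (f : {multiplicative inflation -> inflation}) :
    (forall v, exists u, f u = v) ->
  exists g : M -> M, [/\ f None = None, forall x, f (Some x) = Some (g x),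
    {morph g : x y / x * y}, g 1 = 1 & g m = m
    /\ forall y, exists x, g x = y].
Proof.
move=> f_surj; pose one : inflation := Some 1.
have oneP x : (Some x : inflation) = (Some x : inflation) * one.
  by rewrite [RHS]/mul /= /inflation_mul /= mulg1.
(* [Some x] is a product, so its image is one too, and every product is a [Some]. *)
have fSome x : exists y, f (Some x) = Some y.
  by rewrite oneP gmulfM; eexists.
have fN : f None = None.
  by have [[x|]] := f_surj None => //; have [y ->] := fSome x.
pose g x := deflate (f (Some x)).
have fg x : f (Some x) = Some (g x).
  by rewrite /g; have [y ->] := fSome x.
have gM : {morph g : x y / x * y}.
  by move=> x y; rewrite /g -[Some _]/((Some x : inflation) * Some y) gmulfM.
have g_surj y : exists x, g x = y.
  by have [[x|]] := f_surj (Some y); rewrite ?fN // fg => -[<-]; exists x.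
have g1 : g 1 = 1.
  by have [x gx] := g_surj 1; rewrite -[LHS]mulg1 -[X in _ * X]gx -gM mul1g gx.
exists g; split => //; split=> //.
have : (Some (g m) : inflation) = Some (1 * m).
  by rewrite -fg -[in LHS](mul1g m) -[Some _]/(one * None) gmulfM fN fg g1.
by rewrite mul1g => -[].
Qed.

End Inflation.

(* [U i] is t^i, [X i j] is t^i x t^j, and [Y n] is x t^-n x, with zero [Y 0]. *)
Inductive core := U of int | X of int & int | Y of nat.

Arguments U i%_R.
Arguments X (i j)%_R.

Definition core_code (c : core) : int + int * int + nat :=
  match c with U i => inl (inl i) | X i j => inl (inr (i, j)) | Y n => inr n end.
Definition core_decode (c : int + int * int + nat) : core :=
  match c with inl (inl i) => U i | inl (inr (i, j)) => X i j | inr n => Y n end.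
Lemma core_codeK : cancel core_code core_decode.
Proof. by case. Qed.
HB.instance Definition _ := Choice.copy core (can_type core_codeK).

(** The index of x t^z x among the [Y n]: every [z >= 0] gives the zero [Y 0], and [Negz n] is
    -(n+1). *)
Definition negpart (z : int) : nat := if z is Negz n then n.+1 else 0.

Definition core_mul (a b : core) : core :=
  match a, b with
  | U i, U j => U (i + j)
  | U i, X j k => X (i + j) k
  | X i j, U k => X i (j + k)
  | X i j, X k l => Y (negpart (j + k))
  | U _, Y n | Y n, U _ => Y n
  | _, _ => Y 0
  end%R.

Lemma core_mulA : associative core_mul.
Proof. by case=> [i|i j|n] [k|k l|p] [r|r s|q] //=; rewrite ?GRing.addrA. Qed.

Lemma core_1mul : left_id (U 0) core_mul.
Proof. by case=> [i|i j|n] //=; rewrite GRing.add0r. Qed.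

Lemma core_mul1 : right_id (U 0) core_mul.
Proof. by case=> [i|i j|n] //=; rewrite GRing.addr0. Qed.

HB.instance Definition _ := isMonoid.Build core core_mulA core_1mul core_mul1.

(** Here t is fixed and x goes to t x, so x t^-n x goes to t x t^(1-n) x = x t^(1-n) x; truncation
    in [n.-1] merges [Y 1] with [Y 0]. *)
Definition core_shift (a : core) : core :=
  match a with U i => U i | X i j => X (i + 1) j | Y n => Y n.-1 end.

Lemma core_shiftM : {morph core_shift : a b / a * b}.
Proof.
have negpartS z : negpart (z + 1)%R = (negpart z).-1.
  by case: z => [|[|n]] //=; rewrite subn1.
case=> [i|i j|n] [k|k l|p] //; rewrite /mul /=.
- by rewrite GRing.addrA.
- by rewrite GRing.addrA negpartS.
Qed.

Local Notation x00 := (X 0 0).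

Lemma core_UM i j : U i * U j = U (i + j).
Proof. by []. Qed.

(** With [core_Y], reduces endomorphisms and generation to the [U i] and [x00]. *)
Lemma core_X i j : X i j = U i * x00 * U j.
Proof. by rewrite /mul /= GRing.addr0 GRing.add0r. Qed.

Lemma core_Y n : Y n = x00 * U (- n%:Z) * x00.
Proof. by rewrite /mul /= GRing.addr0 GRing.add0r; case: n. Qed.

Definition ext := inflation_of x00.
Definition ext_base := inflation_base_of x00.

Lemma ext_base_not_hopfian : ~ hopfian ext_base.
Proof.
pose h : ext_base -> ext_base := core_shift.
pose hM := isMultiplicative.Build ext_base ext_base h core_shiftM.
pose hH : {multiplicative ext_base -> ext_base} := HB.pack h hM.
move=> /(_ hH) []; last first.
  by move=> k hK _; have := hK (Y 1); rewrite -[hH (Y 1)]/(hH (Y 0)) hK.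
case=> [i|i j|n]; [exists (U i)|exists (X (i - 1) j)|exists (Y n.+1)] => //.
by congr X; rewrite GRing.subrK.
Qed.

Lemma core_fix_x_surj_endo (g : core -> core) :
    {morph g : a b / a * b} -> g 1 = 1 -> g x00 = x00 ->
    (forall b, exists a, g a = b) ->
  g =1 id.
Proof.
move=> gM g1 gx g_surj.
(* Images of units are units, and a product with a factor [X] or [Y] is never a [U]. *)
have gU i : exists k, g (U i) = U k.
  have : g (U i) * g (U (- i)) = 1.
    by rewrite -gM core_UM GRing.subrr.
  by case: (g _) => [k|k l|n]; [exists k|case: (g _)..].
pose h i : int := if g (U i) is U k then k else 0%R.
have {}gU i : g (U i) = U (h i) by rewrite /h; have [k ->] := gU i.
have hD i j : (h (i + j) = h i + h j)%R.
  by have := gM (U i) (U j); rewrite core_UM !gU => -[].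
have h0 : h 0 = 0%R by have := gU 0%R; rewrite g1 => -[].
have hE i : (h i = i * h 1)%R.
  elim: i => [|n IH|n IH]; first by rewrite h0 GRing.mul0r.
    by rewrite -addn1 PoszD hD IH GRing.mulrDl GRing.mul1r.
  apply: (@GRing.addIr _ (h 1%R)); rewrite -hD -addn1 PoszD GRing.opprD.
  by rewrite GRing.subrK IH GRing.mulrBl GRing.mul1r GRing.subrK.
(* Hence only some [U i] can be sent to [U 1], which forces i * h 1 = 1. *)
have gXneU i j k : g (X i j) <> U k by rewrite core_X !gM gx !gU.
have gYneU n k : g (Y n) <> U k by rewrite core_Y !gM gx !gU.
have h1 : h 1%R = 1%R.
  have [[i|i j|n]] := g_surj (U 1); last 2 first.
  - by move/gXneU.
  - by move/gYneU.
  rewrite gU hE => -[ih1].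
  have [//|h1] : h 1%R = 1%R \/ h 1%R = (-1)%R.
    have /eqP : `|(i * h 1)%R|%N = 1%N by rewrite ih1.
    by rewrite abszM muln_eq1 => /andP[_ /eqP]; lia.
  (* Zero is both x x and x t x; if t went to t^-1, their images would be [Y 0] and [Y 1]. *)
  suff : Y 0 = Y 1 by [].
  transitivity (g (Y 0)); first by rewrite core_Y !gM gx gU h0.
  by rewrite -[Y 0]/(x00 * U 1 * x00) !gM gx gU h1.
have gUid i : g (U i) = U i by rewrite gU hE h1 GRing.mulr1.
case=> [//|i j|n]; first by rewrite core_X !gM gx !gUid.
by rewrite core_Y !gM gx gUid.
Qed.

Lemma ext_hopfian : hopfian ext.
Proof.
move=> f /inflation_surj_endo [g [fN fg gM g1 [gx g_surj]]].
have gid := core_fix_x_surj_endo gM g1 gx g_surj.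
by exists id; case=> [a|]; rewrite /= ?fN // fg gid.
Qed.

Lemma ext_finitely_generated : finitely_generated ext.
Proof.
(* [None] is not a product, so it has to be a generator. *)
pose A : seq ext := [:: Some (U 1); Some (U (-1)); Some x00; None].
have AM a b : generated_by A (Some a) -> generated_by A (Some b) ->
    generated_by A (Some (a * b)).
  by move=> Aa Ab; apply: (generated_by_mul Aa Ab).
have AX : generated_by A (Some x00).
  by apply: generated_by_gen; rewrite !inE eqxx ?orbT.
have AU1 : generated_by A (Some (U 1)).
  by apply: generated_by_gen; rewrite !inE eqxx.
have AUN1 : generated_by A (Some (U (-1))).
  by apply: generated_by_gen; rewrite !inE eqxx ?orbT.
have AU i : generated_by A (Some (U i)).
  (* Empty products are excluded, so [U 0] is obtained as t t^-1. *)
  elim: i => [|n IH|n IH]; first exact: AM AU1 AUN1.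
    by rewrite -addn1; apply: AM IH AU1.
  by rewrite -addn1 PoszD GRing.opprD; apply: AM IH AUN1.
exists A => -[[i|i j|n]|] //.
- by rewrite (core_X i j); exact: (AM _ _ (AM _ _ (AU i) AX) (AU j)).
- by rewrite core_Y; exact: (AM _ _ (AM _ _ AX (AU _)) AX).
- by apply: generated_by_gen; rewrite !inE eqxx ?orbT.
Qed.

Theorem theorem5p7 :
  exists (S : semigroupType) (P : pred S) (T : subSemigroupType P),
    [/\ finitely_generated S, hopfian S, ~ hopfian T
      & exists a : S, [predC P] =i pred1 a].
Proof.
exists ext, (@isSome core), ext_base; split.
- exact: ext_finitely_generated.
- exact: ext_hopfian.
- exact: ext_base_not_hopfian.
- by exists None; case.
Qed.
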